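(* Let $P$ be a graded poset with unique minimal element $\hat0$ and unique maximal element $\hat1$, of rank $r$, whose atoms are labeled by monomials in $\mathbf{k}[x_1,\dots,x_n]$, and let $I_P$ be its poset ideal. Suppose the labeled poset $P$ is complete and that $\widetilde H_i(\Delta(F_{(i+3)}))=0$ for all $0\le i\le r-3$ and all $F\in P$ of rank $\ge i+3$. Then $(\mathcal{C}(P),\partial)$ is a minimal $\mathbb{N}^n$-graded free $\mathbf{k}[\mathbf{x}]$-resolution of $I_P$.
   Context: Labels: for $F\ne\hat0$, $m_F=\mathrm{lcm}\{m_A: A \text{ an atom}, A\le F\}$, and $m_{\hat0}=1$; $I_P$ is generated by the atom labels. $P$ is complete if all $m_F$ are distinct and for every $\mathbf{a}\in\mathbb{N}^n$ the set $\{F\in P:\deg m_F\le\mathbf{a}\}$ has a unique maximal element. For $F\in P$, $\Delta(F)$ is the order complex of $(\hat0,F)$ with $i$-simplices the chains $[F_0,\dots,F_i]$, $F>F_0>\dots>F_i>\hat0$; $C_i(\Delta(F))$ are $\mathbf{k}$-chains ($C_{-1}=\mathbf{k}$ spanned by the empty chain), augmented boundary $\partial[F_0,\dots,F_i]=\sum_j(-1)^j[F_0,\dots,\widehat{F_j},\dots,F_i]$, $\partial[F_0]=\emptyset$; $Z_i(\Delta(F))$ the cycles. For $\mathrm{rk}F-\mathrm{rk}F'=1$, $\phi:Z_i(\Delta(F))\to Z_{i-1}(\Delta(F'))$ maps $[F_0,\dots,F_i]$ to $[F_1,\dots,F_i]$ if $F_0=F'$ and to $0$ otherwise; for atoms $A$,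 $\phi$ maps the empty chain of $Z_{-1}(\Delta(A))$ to $1\in\mathbf{k}$ (the term for $\hat0$). $F_{(j)}$ is the lower interval $[\hat0,F]$ with all elements of rank $\ge j$ removed, and $\Delta(F_{(j)})$ is the order complex of the proper part of $F_{(j)}\cup\{F\}$. $\langle m_F\rangle$ is the free rank-one $\mathbb{N}^n$-graded module generated in degree $\deg m_F$. $\mathcal{C}(P)=\bigoplus_{F\in P}Z_{\mathrm{rk}(F)-2}(\Delta(F))\otimes_\mathbf{k}\langle m_F\rangle$, where the summand of $F$ sits in homological degree $\mathrm{rk}(F)-1$ and the summand for $F=\hat0$ is $\mathbf{k}\otimes\langle 1\rangle=\mathbf{k}[\mathbf{x}]$ in degree $-1$; the differential is $\partial=\phi\otimes(\text{inclusion }\langle m_F\rangle\to\langle m_{F'}\rangle)$. ''Minimal free resolution of $I_P$'' means: the part in homological degrees $\ge0$ is exact, the image of the degree-$0$ part in $\mathbf{k}[\mathbf{x}]$ is $I_P$, and the resolution is minimal. *)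

(* Defs.v *)
From HB Require Import structures.
From mathcomp Require Import all_boot all_order all_algebra.
From mathcomp Require Import mpoly.

Set Implicit Arguments.
Unset Strict Implicit.
Unset Printing Implicit Defensive.

Import Order.TTheory GRing.Theory.
Local Open Scope ring_scope.

Section OrderComplex.
Variables (disp : Order.disp_t) (P : finPOrderType disp).
Implicit Types V : {set P}.

(* Simplices are indexed by their number s of vertices: s.-tuples are the
   (s-1)-simplices [F_0, ..., F_(s-1)], F_0 > ... > F_(s-1), and the unique
   0-tuple is the empty simplex, of dimension -1. *)
Definition is_simplex V (s : nat) (t : s.-tuple P) : bool :=
  sorted >%O t && all (mem V) t.

Definition face (s : nat) (u : s.-tuple P) (j : 'I_s) : s.-1.-tuple P :=
  [tuple tnth u (lift j i) | i < s.-1].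

Section Coefficients.
Variable R : comNzRingType.

Definition basis_chain (s : nat) (t : s.-tuple P) : {ffun s.-tuple P -> R^o} :=
  [ffun u => (u == t)%:R].

Definition is_chain V (s : nat) (c : {ffun s.-tuple P -> R^o}) : Prop :=
  forall t, c t != 0 -> is_simplex V t.

(* Augmented boundary; it is 0 for s = 0. *)
Definition boundary (s : nat) (c : {ffun s.-tuple P -> R^o}) :
    {ffun s.-1.-tuple P -> R^o} :=
  \sum_(u : s.-tuple P)
     c u *: (\sum_(j < s) (-1) ^+ j *: basis_chain (face u j)).

(* The elements of Z_(s-1). *)
Definition is_cycle V (s : nat) (c : {ffun s.-tuple P -> R^o}) : Prop :=
  is_chain V c /\ boundary c = 0.

(* Reduced homology with coefficients in R of the order complex of V,
   in dimension i >= 0. *)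
Definition reduced_homology_vanishes V (i : nat) : Prop :=
  forall z : {ffun i.+1.-tuple P -> R^o}, is_cycle V z ->
  exists2 c : {ffun i.+2.-tuple P -> R^o}, is_chain V c & boundary c = z.

(* Defined for every coefficient ring R: over k this is phi, and over
   R = k[x] it is phi (x) id_(k[x]). *)
Definition phi (F' : P) (s : nat) (c : {ffun s.+1.-tuple P -> R^o}) :
    {ffun s.-tuple P -> R^o} :=
  \sum_(u : s.+1.-tuple P)
     c u *: (if thead u == F' then basis_chain [tuple of behead u] else 0).

End Coefficients.
End OrderComplex.

Section LabeledPoset.
Variables (disp : Order.disp_t) (P : finTBPOrderType disp).

Definition covered (F G : P) : bool :=
  (F < G)%O && [forall H, ~~ ((F < H)%O && (H < G)%O)].

Definition atom (A : P) : bool := covered \bot%O A.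

Definition is_rank_function (rk : P -> nat) : Prop :=
  rk \bot%O = 0%N /\ forall F G, covered F G -> rk G = (rk F).+1.

(* Vertex set of Delta(F). *)
Definition open_below (F : P) : {set P} := [set G | (\bot < G)%O && (G < F)%O].

(* F_(j) *)
Definition truncation (rk : P -> nat) (F : P) (j : nat) : {set P} :=
  [set G | (G <= F)%O && (rk G < j)%N].

(* Vertex set of Delta(F_(j)): F_(j) together with F is bounded by \bot and F. *)
Definition truncation_proper_part (rk : P -> nat) (F : P) (j : nat) : {set P} :=
  (F |: truncation rk F j) :\: [set \bot%O; F].

Variables (n : nat) (lab : {A : P | atom A} -> 'X_{1..n}).

(* m_F as an exponent vector; no atom lies below \bot, so m_\bot = 1. *)
Definition label (F : P) : 'X_{1..n} :=
  \big[@mlcm n/0%MM]_(A : {A : P | atom A} | (val A <= F)%O) lab A.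

Definition maximal_below_degree (a : 'X_{1..n}) (F : P) : Prop :=
  (label F <= a)%MM /\
  forall G, (label G <= a)%MM -> (F <= G)%O -> G = F.

Definition complete : Prop :=
  injective label /\
  forall a : 'X_{1..n}, exists! F, maximal_below_degree a F.

(* I_P *)
Definition poset_ideal (k : fieldType) (p : {mpoly k[n]}) : Prop :=
  exists q : {A : P | atom A} -> {mpoly k[n]}, p = \sum_A q A * 'X_[lab A].

End LabeledPoset.

Section GradedModules.
Variables (k : fieldType) (n : nat).
Notation S := {mpoly k[n]}.

(* An N^n-graded k[x]-module, given as the submodule gmem of an ambient
   k[x]-module together with its homogeneous components gcomp a. The module
   axioms are not fields of the record: they follow from graded_free. *)
Record gmodule := GModule {
  gambient :> lmodType S;
  gmem : gambient -> Prop;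
  gcomp : 'X_{1..n} -> gambient -> Prop }.

Definition homogeneous_of_degree (a : 'X_{1..n}) (p : S) : Prop :=
  forall b, b \in msupp p -> b = a.

Definition gring : gmodule :=
  @GModule (S^o : lmodType S) (fun=> True) homogeneous_of_degree.

(* A finite homogeneous basis b with degrees e: gmem is freely generated by b,
   and gcomp a consists of the combinations whose i-th coefficient is
   homogeneous of degree a - e i (hence is 0 unless e i <= a). *)
Definition graded_free (M : gmodule) : Prop :=
  exists (N : nat) (b : 'I_N -> M) (e : 'I_N -> 'X_{1..n}),
  [/\ forall v, gmem v <-> exists p : 'I_N -> S, v = \sum_i p i *: b i,
      forall p : 'I_N -> S, \sum_i p i *: b i = 0 -> forall i, p i = 0
    & forall a v, gcomp a v <->
        exists2 p : 'I_N -> S,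
          forall i c, c \in msupp (p i) -> (e i + c)%MM = a
        & v = \sum_i p i *: b i].

Definition graded_hom (M N : gmodule) (f : M -> N) : Prop :=
  [/\ forall v, gmem v -> gmem (f v),
      forall (p : S) v w, gmem v -> gmem w -> f (p *: v + w) = p *: f v + f w
    & forall a v, gcomp a v -> gcomp a (f v)].

(* (x_1, ..., x_n) M *)
Definition in_maximal_ideal_mul (M : gmodule) (v : M) : Prop :=
  exists2 w : 'I_n -> M, forall i, gmem (w i) & v = \sum_i ('X_i : S) *: w i.

Definition minimal_graded_free_resolution (C : nat -> gmodule)
    (del : forall d, C d.+1 -> C d) (aug : C 0%N -> gring) (I : S -> Prop) :
    Prop :=
  [/\ (forall d, graded_free (C d)),
      (forall d, graded_hom (del d)) /\ graded_hom aug,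
      (forall d (v : C d.+1), gmem v ->
         (del d v = 0 <-> exists2 w : C d.+2, gmem w & del d.+1 w = v)) /\
      (forall v : C 0%N, gmem v ->
         (aug v = 0 <-> exists2 w : C 1%N, gmem w & del 0%N w = v)),
      (forall p : S, I p <-> exists2 v : C 0%N, gmem v & aug v = p)
    & (forall d (v : C d.+1), gmem v -> in_maximal_ideal_mul (del d v))].

(* For a subspace Z of k^T, the subspace Z (x)_k <m> of
   k^T (x)_k k[x] = k[x]^T, where <m> is the principal ideal generated by the
   monomial x^m: finite sums of pure tensors z (x) q x^m. *)
Definition tensor_monomial (T : finType) (Z : {ffun T -> k^o} -> Prop)
    (m : 'X_{1..n}) (c : {ffun T -> S^o}) : Prop :=
  exists (N : nat) (z : 'I_N -> {ffun T -> k^o}) (q : 'I_N -> S),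
    (forall j, Z (z j)) /\
    c = \sum_j [ffun t => (z j t)%:MP * (q j * 'X_[m])].

End GradedModules.

Section PosetComplex.
Variables (k : fieldType) (n : nat).
Variables (disp : Order.disp_t) (P : finTBPOrderType disp).
Variables (rk : P -> nat) (lab : {A : P | atom A} -> 'X_{1..n}).
Notation S := {mpoly k[n]}.

(* Homological degree d >= 0 of C(P). The summand of F is nonzero only for
   rk F = d + 1, where Z_(rk F - 2) lives on chains with d elements. *)
Definition poset_chain (d : nat) : lmodType S :=
  {ffun P -> {ffun d.-tuple P -> S^o}}.

Definition poset_mem (d : nat) (c : poset_chain d) : Prop :=
  forall F : P,
    if rk F == d.+1 then
      tensor_monomial (@is_cycle _ P k (open_below F) d) (label lab F) (c F)
    else c F = 0.

(* The degree a part, for the grading that k^T (x) <m_F> inherits from k[x]. *)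
Definition poset_comp (d : nat) (a : 'X_{1..n}) (c : poset_chain d) : Prop :=
  poset_mem c /\ forall F t, homogeneous_of_degree a (c F t : S).

Definition poset_module (d : nat) : gmodule k n :=
  GModule (@poset_mem d) (@poset_comp d).

Definition poset_del (d : nat) (c : poset_module d.+1) : poset_module d :=
  [ffun F' : P => \sum_(F : P | rk F == (rk F').+1) phi F' (c F)].

(* The differential onto the summand k[x] of \bot, in degree -1. *)
Definition poset_aug (c : poset_module 0) : gring k n :=
  \sum_(A : P | atom A) c A [tuple].

End PosetComplex.

(* Main.v *)
Require Import Defs.
From HB Require Import structures.
From mathcomp Require Import all_boot all_order all_algebra.
From mathcomp Require Import mpoly.

Set Implicit Arguments.
Unset Strict Implicit.
Unset Printing Implicit Defensive.

Import Order.TTheory GRing.Theory.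

(** Fix an exponent [a]. The elements of P whose label divides [x^a] form a
    lower set L. Replacing each cycle of the summand of F by the cone over it
    with apex F identifies the degree-[a] strand of C(P) with the cellular
    chains of the order complex of L filtered by rank: its degree-[d] part
    consists of the chains on elements of rank at most [d + 1] whose boundary
    only involves elements of rank at most [d], and the differential becomes
    the simplicial boundary. So the strand is exact at [d] as soon as every
    [d]-cycle bounds among the elements of rank at most [d + 2]. By completeness
    L has a largest element G, and this is the homology hypothesis when
    [rk G >= d + 3]; otherwise G itself, unless it is [\bot] and there is
    nothing to prove, is among these elements and cycles are coned off with apex
    G. Minimality holds because distinct labels make [m_F] a proper divisor of
    [m_G] for F < G. *)

Section Tuples.

Lemma sum_tupleS (T : finType) (V : nmodType) (s : nat)
    (f : s.+1.-tuple T -> V) :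
  (\sum_u f u = \sum_x \sum_(t : s.-tuple T) f [tuple of x :: t])%R.
Proof.
rewrite pair_big /=.
rewrite (reindex (fun p : T * s.-tuple T => [tuple of p.1 :: p.2])) //=.
exists (fun u => (thead u, [tuple of behead u])) => [[x t] _|u _].
  by congr pair; apply: val_inj.
by rewrite [RHS]tuple_eta.
Qed.

Lemma cons_tuple_eqE (T : eqType) (s : nat) (x y : T) (t u : s.-tuple T) :
  ([tuple of x :: t] == [tuple of y :: u]) = (x == y) && (t == u).
Proof. by rewrite -!val_eqE /= eqseq_cons. Qed.

Lemma behead_cons_tuple (T : Type) (s : nat) (x : T) (t : s.-tuple T) :
  [tuple of behead [tuple of x :: t]] = t.
Proof. exact: val_inj. Qed.

End Tuples.

Section Chains.
Local Open Scope ring_scope.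
Variables (disp : Order.disp_t) (P : finPOrderType disp).
Variable R : comNzRingType.
Implicit Types (F G : P) (s : nat).

Lemma face_cons0 s F (t : s.+1.-tuple P) : face [tuple of F :: t] ord0 = t.
Proof. by apply: eq_from_tnth => i; rewrite tnth_mktuple tnthS. Qed.

Lemma face_consS s F (t : s.+1.-tuple P) j :
  face [tuple of F :: t] (lift ord0 j) = [tuple of F :: face t j].
Proof.
apply: eq_from_tnth => i; rewrite tnth_mktuple.
case: (unliftP ord0 i) => [i'|] -> /=; last first.
  by rewrite tnth0 (_ : lift _ _ = ord0) ?tnth0 //; apply: val_inj.
rewrite tnthS tnth_mktuple.
rewrite (_ : lift (lift ord0 j) _ = lift ord0 (lift j i')) ?tnthS //.
by apply: val_inj; rewrite /= /bump /= !add1n ltnS addnS.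
Qed.

Lemma phiE F s (c : {ffun s.+1.-tuple P -> R^o}) (t : s.-tuple P) :
  phi F c t = c [tuple of F :: t].
Proof.
rewrite /phi sum_ffunE sum_tupleS (bigD1 F) //= [X in _ + X]big1 ?addr0.
  rewrite (bigD1 t) //= big1 ?addr0 => [|u nu]; rewrite !ffunE theadE eqxx
    behead_cons_tuple ffunE.
    by rewrite eqxx; apply: mulr1.
  by rewrite [t == u]eq_sym (negPf nu) scaler0.
move=> G nG; apply: big1 => u _.
by rewrite !ffunE theadE (negPf nG) ffunE scaler0.
Qed.

Lemma phi_linear F s : linear (@phi _ P R F s).
Proof. by move=> a c c'; apply/ffunP => t; rewrite !(phiE, ffunE). Qed.
HB.instance Definition _ F s :=
  GRing.isLinear.Build R _ _ _ (@phi _ P R F s) (@phi_linear F s).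

Lemma chain_phiP s (c c' : {ffun s.+1.-tuple P -> R^o}) :
  (forall F, phi F c = phi F c') -> c = c'.
Proof.
move=> eq_phi; apply/ffunP => u; case/tupleP: u => F t.
by rewrite -!phiE eq_phi.
Qed.

Lemma boundaryE s (c : {ffun s.-tuple P -> R^o}) t :
  boundary c t = \sum_u c u * \sum_(j < s) (-1) ^+ j * (t == face u j)%:R.
Proof.
rewrite /boundary sum_ffunE; apply: eq_bigr => u _; rewrite ffunE sum_ffunE.
congr (_ * _); apply: eq_bigr => j _; rewrite !ffunE; exact: erefl.
Qed.

Lemma boundary_linear s : linear (@boundary _ P R s).
Proof.
move=> a c c'; apply/ffunP => t; rewrite !ffunE !boundaryE.
rewrite scaler_sumr -big_split; apply: eq_bigr => u _ /=.
by rewrite !ffunE mulrDl -scalerAl.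
Qed.
HB.instance Definition _ s :=
  GRing.isLinear.Build R _ _ _ (@boundary _ P R s) (@boundary_linear s).

Lemma boundary_empty (c : {ffun 0.-tuple P -> R^o}) : boundary c = 0.
Proof.
by apply/ffunP => t; rewrite boundaryE ffunE big1 // => u _;
  rewrite big_ord0 mulr0.
Qed.

(* The face operator d_0. *)
Definition drop_top s (c : {ffun s.+1.-tuple P -> R^o}) :
    {ffun s.-tuple P -> R^o} :=
  \sum_F phi F c.

Lemma drop_topE s (c : {ffun s.+1.-tuple P -> R^o}) t :
  drop_top c t = \sum_F c [tuple of F :: t].
Proof. by rewrite sum_ffunE; apply: eq_bigr => F _; rewrite phiE. Qed.

Lemma boundary_point (c : {ffun 1.-tuple P -> R^o}) : boundary c = drop_top c.
Proof.
apply/ffunP => t; rewrite boundaryE drop_topE sum_tupleS.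
apply: eq_bigr => F _.
have eq_empty (u v : 0.-tuple P) : u = v by rewrite (tuple0 u) (tuple0 v).
rewrite (bigD1 t) //= [X in _ + X]big1 ?addr0 => [|u]; last first.
  by rewrite (eq_empty u t) eqxx.
rewrite big_ord_recl big_ord0 addr0 mul1r (_ : t == _) ?mulr1 //.
exact/eqP/eq_empty.
Qed.

Lemma phi_boundary s F (c : {ffun s.+2.-tuple P -> R^o}) :
  phi F (boundary c) = phi F (drop_top c) - boundary (phi F c).
Proof.
apply/ffunP => t; rewrite phiE !ffunE phiE drop_topE.
rewrite (boundaryE c) sum_tupleS.
under eq_bigr do
  under eq_bigr do rewrite big_ord_recl mulrDr expr0 mul1r face_cons0.
under eq_bigr do rewrite big_split /=.
rewrite big_split /=; congr (_ + _).
  apply: eq_bigr => G _; rewrite (bigD1 [tuple of F :: t]) //= eqxx mulr1.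
  by rewrite big1 ?addr0 // => u nu; rewrite [_ == u]eq_sym (negPf nu) mulr0.
rewrite (bigD1 F) //= [X in _ + X]big1 ?addr0 => [|G nG]; last first.
  apply: big1 => u _; rewrite big1 ?mulr0 // => j _.
  by rewrite face_consS cons_tuple_eqE [F == G]eq_sym (negPf nG) mulr0.
rewrite (boundaryE (phi F c)) -sumrN; apply: eq_bigr => u _.
rewrite phiE -mulrN -sumrN; congr (_ * _); apply: eq_bigr => j _.
by rewrite face_consS cons_tuple_eqE eqxx /bump /= exprS mulN1r mulNr.
Qed.

Lemma drop_top_boundary s (c : {ffun s.+2.-tuple P -> R^o}) :
  drop_top (boundary c) = drop_top (drop_top c) - boundary (drop_top c).
Proof.
rewrite /drop_top (eq_bigr _ (fun F _ => phi_boundary F c)) sumrB.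
by rewrite [boundary (\sum_G _)]linear_sum.
Qed.

Lemma boundary_boundary s (c : {ffun s.+1.-tuple P -> R^o}) :
  boundary (boundary c) = 0.
Proof.
elim: s c => [|s IHs] c; first exact: boundary_empty.
case: s IHs c => [_|s IHs] c.
  by rewrite boundary_point drop_top_boundary boundary_point subrr.
apply: chain_phiP => F; rewrite !phi_boundary linearB /= IHs subr0 linear0.
rewrite drop_top_boundary !linearB /= phi_boundary.
by rewrite opprB addrCA subrr addr0 subrr.
Qed.

Definition cone F s (c : {ffun s.-tuple P -> R^o}) :
    {ffun s.+1.-tuple P -> R^o} :=
  [ffun u => (thead u == F)%:R * c [tuple of behead u]].

Lemma phi_cone F G s (c : {ffun s.-tuple P -> R^o}) :
  phi F (cone G c) = if F == G then c else 0.
Proof.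
apply/ffunP => t; rewrite phiE !ffunE theadE behead_cons_tuple.
by case: eqP => _; rewrite ?mul1r // mul0r ffunE.
Qed.

Lemma phi_sum_cone F s (c : P -> {ffun s.-tuple P -> R^o}) :
  phi F (\sum_G cone G (c G)) = c F.
Proof.
rewrite linear_sum (bigD1 F) //= phi_cone eqxx big1 ?addr0 // => G.
by rewrite phi_cone eq_sym => /negPf->.
Qed.

Lemma drop_top_cone F s (c : {ffun s.-tuple P -> R^o}) :
  drop_top (cone F c) = c.
Proof.
rewrite /drop_top (bigD1 F) //= phi_cone eqxx big1 ?addr0 // => G /negPf nG.
by rewrite phi_cone nG.
Qed.

Lemma boundary_cone F s (c : {ffun s.-tuple P -> R^o}) :
  boundary c = 0 -> boundary (cone F c) = c.
Proof.
case: s c => [|s] c bc; first by rewrite boundary_point drop_top_cone.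
apply: chain_phiP => G; rewrite phi_boundary drop_top_cone phi_cone.
by case: ifP => _; rewrite (bc, linear0) subr0.
Qed.

Lemma boundary_drop_top s (c : {ffun s.+1.-tuple P -> R^o}) :
  (forall F, boundary (phi F c) = 0) -> boundary c = drop_top c.
Proof.
move=> phi_cycle; have {1}-> : c = \sum_F cone F (phi F c).
  by apply: chain_phiP => F; rewrite phi_sum_cone.
by rewrite linear_sum; apply: eq_bigr => F _; apply: boundary_cone.
Qed.

End Chains.

Section ChainSupport.
Local Open Scope ring_scope.
Variables (disp : Order.disp_t) (P : finPOrderType disp) (R : comNzRingType).
Implicit Types (F G : P) (V W : {set P}) (s : nat).

Lemma simplexS V W s (t : s.-tuple P) :
  V \subset W -> is_simplex V t -> is_simplex W t.
Proof.
by move=> /subsetP sVW /andP[st tV]; rewrite /is_simplex st; apply: sub_all tV.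
Qed.

Lemma simplex_consE V F s (t : s.-tuple P) :
  is_simplex V [tuple of F :: t]
    = (F \in V) && is_simplex [set G in V | (G < F)%O] t.
Proof.
rewrite /is_simplex /= (path_sortedE (rev_trans lt_trans)).
have -> : all (mem [set G in V | (G < F)%O]) t
    = all (mem V) t && all (fun G => G < F)%O t.
  by rewrite -all_predI; apply: eq_all => G; rewrite /= inE.
by rewrite -!andbA; do !bool_congr.
Qed.

Lemma is_chain0 V s : is_chain V (0 : {ffun s.-tuple P -> R^o}).
Proof. by move=> t; rewrite ffunE eqxx. Qed.

Lemma is_chainS V W s (c : {ffun s.-tuple P -> R^o}) :
  V \subset W -> is_chain V c -> is_chain W c.
Proof. by move=> sVW cV t /cV; apply: simplexS. Qed.

Lemma phi_notin V F s (c : {ffun s.+1.-tuple P -> R^o}) :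
  is_chain V c -> F \notin V -> phi F c = 0.
Proof.
move=> cV nF; apply/ffunP => t; rewrite phiE [RHS]ffunE; apply/eqP.
by apply: contraNT nF => /cV; rewrite simplex_consE => /andP[].
Qed.

Lemma drop_top_neq0 V s (c : {ffun s.+1.-tuple P -> R^o}) t :
  is_chain V c -> drop_top c t != 0 ->
  exists2 F, F \in V & is_simplex [set G in V | (G < F)%O] t.
Proof.
move=> cV; rewrite drop_topE => nz.
have [F nzF] : exists F, c [tuple of F :: t] != 0.
  apply/existsP; apply: contraNT nz => /existsPn z.
  by rewrite big1 // => F _; apply/eqP; have := z F; rewrite negbK.
by exists F; have := cV _ nzF; rewrite simplex_consE => /andP[].
Qed.

Lemma phi_drop_top_neq0 V F s (c : {ffun s.+2.-tuple P -> R^o}) :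
  is_chain V c -> phi F (drop_top c) != 0 -> exists2 G, G \in V & (F < G)%O.
Proof.
move=> cV nz; have [t] : exists t, phi F (drop_top c) t != 0.
  apply/existsP; apply: contraNT nz => /existsPn z; apply/eqP/ffunP => t.
  by have := z t; rewrite negbK [RHS]ffunE => /eqP.
rewrite phiE => /(drop_top_neq0 cV)[G GV].
by rewrite simplex_consE !inE => /andP[/andP[_ ltFG] _]; exists G.
Qed.

Lemma is_chain_cone V F s (c : {ffun s.-tuple P -> R^o}) :
  F \in V -> is_chain [set G in V | (G < F)%O] c -> is_chain V (cone F c).
Proof.
move=> FV cV u; case/tupleP: u => G t; rewrite -phiE phi_cone simplex_consE.
by case: (G =P F) => [->|_]; [rewrite FV => /cV | rewrite ffunE eqxx].
Qed.

Lemma reduced_homology_vanishes_max V G i :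
  G \in V -> (forall F, F \in V -> (F <= G)%O) ->
  reduced_homology_vanishes R V i.
Proof.
move=> GV maxG z [zV bz].
have top_cycle : boundary (phi G z) = 0.
  case: i z zV bz => [|i] z zV bz; first exact: boundary_empty.
  have drop0 : phi G (drop_top z) = 0.
    apply/eqP; apply: contraT => /(phi_drop_top_neq0 zV)[F /maxG leFG].
    by move/lt_geF; rewrite leFG.
  have := phi_boundary G z; rewrite bz drop0 linear0 sub0r => /esym/eqP.
  by rewrite oppr_eq0 => /eqP.
(* The part of z that avoids G; its cone with apex G has boundary z. *)
pose z_off := z - cone G (phi G z).
have phi_z_off F : phi F z_off = if F == G then 0 else phi F z.
  by rewrite linearB /= phi_cone; case: eqP => [->|_]; rewrite ?subrr ?subr0.
have bz_off : boundary z_off = - phi G z.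
  by rewrite linearB /= bz boundary_cone // sub0r.
exists (cone G z_off).
  apply: is_chain_cone => // u; case/tupleP: u => F t; rewrite -phiE phi_z_off.
  case: (F =P G) => [_|/eqP nF]; first by rewrite ffunE eqxx.
  rewrite phiE => /zV; rewrite !simplex_consE !inE => /andP[FV tF].
  have ltFG : (F < G)%O by rewrite lt_neqAle nF maxG.
  rewrite FV ltFG; apply: simplexS tF; apply/subsetP => H.
  by rewrite !inE => /andP[-> ltHF]; rewrite ltHF (lt_trans ltHF ltFG).
apply: chain_phiP => F; rewrite phi_boundary drop_top_cone phi_z_off phi_cone.
by case: eqP => [->|_]; rewrite ?bz_off ?opprK ?add0r // linear0 subr0.
Qed.

End ChainSupport.

Section RankedPoset.
Variables (disp : Order.disp_t) (P : finTBPOrderType disp) (rk : P -> nat).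
Hypothesis rk_graded : is_rank_function rk.
Implicit Types F G : P.

Lemma rk_lt F G : (F < G)%O -> rk F < rk G.
Proof.
have [m] := ubnP #|[set H | (F < H < G)%O]|.
elim: m F G => // m IH F G; rewrite ltnS => le_m ltFG.
have [cov|] := boolP (covered F G); first by rewrite (rk_graded.2 F G).
rewrite /covered ltFG /= => /forallPn[H]; rewrite negbK => /andP[ltFH ltHG].
have between_lt (A B : P) : (F <= A)%O -> (B <= G)%O ->
    ~~ (A < H < B)%O -> #|[set K | (A < K < B)%O]| < m.
  move=> leFA leBG nH; apply: leq_trans le_m; apply: proper_card.
  apply/properP; split; last by exists H; rewrite !inE ?ltFH ?ltHG.
  apply/subsetP => K; rewrite !inE => /andP[ltAK ltKB].
  by rewrite (le_lt_trans leFA ltAK) (lt_le_trans ltKB leBG).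
apply: (@ltn_trans (rk H)); apply: IH => //; apply: between_lt => //.
- exact: ltW.
- by rewrite ltxx andbF.
- exact: ltW.
by rewrite ltxx.
Qed.

Lemma rk_le F G : (F <= G)%O -> rk F <= rk G.
Proof. by rewrite le_eqVlt => /orP[/eqP->//|/rk_lt/ltnW]. Qed.

Lemma rk_gt0 F : (0 < rk F) = (\bot < F)%O.
Proof.
have [->|nF] := eqVneq F \bot%O; first by rewrite rk_graded.1 ltxx.
have lt0F : (\bot < F)%O by rewrite lt0x.
by rewrite lt0F -rk_graded.1 rk_lt.
Qed.

Lemma atom_rk F : atom F = (rk F == 1).
Proof.
apply/idP/eqP => [/rk_graded.2->|rkF]; first by rewrite rk_graded.1.
rewrite /atom /covered -rk_gt0 rkF /=; apply/forallP => H; apply/negP.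
by rewrite -rk_gt0 => /andP[H0 /rk_lt]; rewrite rkF ltnNge H0.
Qed.

Lemma simplex_open_below_consE F G s (t : s.-tuple P) :
  is_simplex (open_below F) [tuple of G :: t]
    = (\bot < G < F)%O && is_simplex (open_below G) t.
Proof.
rewrite simplex_consE inE; case: (boolP (\bot < G < F)%O) => //= /andP[_ ltGF].
suff -> : [set H in open_below F | (H < G)%O] = open_below G by [].
apply/setP => H; rewrite !inE; case: (boolP (H < G)%O) => ltHG.
  by rewrite (lt_trans ltHG ltGF) !andbT.
by rewrite !andbF.
Qed.

Lemma simplex_open_below_rk F s (t : s.-tuple P) :
  (\bot < F)%O -> is_simplex (open_below F) t -> s < rk F.
Proof.
elim: s F t => [|s IH] F t; first by rewrite rk_gt0.
case/tupleP: t => G t _; rewrite simplex_open_below_consE.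
by case/andP=> /andP[lt0 /rk_lt ltGF] /(IH _ _ lt0)/leq_ltn_trans; apply.
Qed.

Definition rank_skeleton (L : {set P}) j : {set P} :=
  [set F in L | 0 < rk F <= j].

Section CellularChains.
Local Open Scope ring_scope.
Variables (R : comNzRingType) (L : {set P}).
Hypothesis L_lower : forall F G, (F <= G)%O -> G \in L -> F \in L.

(* The cellular chains of the order complex of L filtered by rank, that is,
   the relative cycles H_d(skeleton (d + 1), skeleton d). *)
Definition is_cellular d (c : {ffun d.+1.-tuple P -> R^o}) : Prop :=
  is_chain (rank_skeleton L d.+1) c /\
  is_chain (rank_skeleton L d) (boundary c).

Lemma simplex_rank_skeleton_consE d F (t : d.-tuple P) :
  is_simplex (rank_skeleton L d.+1) [tuple of F :: t]
    = [&& F \in L, rk F == d.+1 & is_simplex (open_below F) t].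
Proof.
have skeletonP G : (G \in [set H in rank_skeleton L d.+1 | (H < F)%O])
    = [&& G \in L, (\bot < G)%O, (rk G <= d.+1)%N & (G < F)%O].
  by rewrite !inE rk_gt0 -!andbA.
rewrite simplex_consE inE rk_gt0 -!andbA; apply/and4P/and3P.
  case=> FL lt0 le_rk tV; have tF : is_simplex (open_below F) t.
    apply: simplexS tV; apply/subsetP => G.
    by rewrite skeletonP inE => /and4P[_ -> _ ->].
  by rewrite eqn_leq le_rk (simplex_open_below_rk lt0 tF).
case=> FL /eqP rkF tF; rewrite rkF -rk_gt0 rkF; split=> //.
apply: simplexS tF; apply/subsetP => G; rewrite skeletonP inE => /andP[-> ltGF].
by rewrite (L_lower (ltW ltGF) FL) ltGF -rkF (rk_le (ltW ltGF)).
Qed.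

Lemma cellularP d (c : {ffun d.+1.-tuple P -> R^o}) :
  is_cellular c <->
  forall F, if (F \in L) && (rk F == d.+1)
            then is_cycle (open_below F) (phi F c) else phi F c = 0.
Proof.
split=> [[cV bcV] F|cF].
  case: ifPn => [/andP[FL /eqP rkF]|nF]; last first.
    apply/ffunP => t; rewrite phiE [RHS]ffunE; apply/eqP.
    apply: contraNT nF => /cV.
    by rewrite simplex_rank_skeleton_consE => /and3P[-> ->].
  split=> [t|].
    by rewrite phiE => /cV; rewrite simplex_rank_skeleton_consE => /and3P[].
  case: d c cV bcV rkF => [|d] c cV bcV rkF; first exact: boundary_empty.
  have := phi_boundary F c; rewrite (phi_notin bcV) ?inE ?rkF ?ltnn ?andbF //.
  move=> /esym/eqP; rewrite subr_eq0 => /eqP<-.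
  apply/eqP; apply: contraT => /(phi_drop_top_neq0 cV)[G].
  by rewrite !inE => /and3P[_ _ +] /rk_lt; rewrite rkF leqNgt => /negP.
have cV : is_chain (rank_skeleton L d.+1) c.
  move=> u; case/tupleP: u => F t; rewrite simplex_rank_skeleton_consE -phiE.
  have := cF F; case: ifP => [/andP[-> ->] [cF_open _] /cF_open //|_ ->].
  by rewrite ffunE eqxx.
split=> //; case: d c cF cV => [|d] c cF cV u; first by rewrite (tuple0 u).
rewrite boundary_drop_top => [|F]; last first.
  by have := cF F; case: ifP => [_ []|_ ->] //; rewrite linear0.
case/(drop_top_neq0 cV) => G; rewrite !inE => /and3P[_ _ leG].
apply: simplexS; apply/subsetP => H; rewrite !inE.
by case/andP=> /and3P[-> -> _] /rk_lt/leq_trans/(_ leG).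
Qed.

Lemma cellular_drop_top d (c : {ffun d.+1.-tuple P -> R^o}) :
  is_cellular c -> boundary c = drop_top c.
Proof.
move=> /cellularP cF; apply: boundary_drop_top => F.
by have := cF F; case: ifP => [_ []|_ ->] //; rewrite linear0.
Qed.

Lemma cellular0 d : is_cellular (0 : {ffun d.+1.-tuple P -> R^o}).
Proof. by split; rewrite ?linear0; apply: is_chain0. Qed.

Lemma cellular_boundary d (c : {ffun d.+2.-tuple P -> R^o}) :
  is_cellular c -> is_cellular (boundary c).
Proof.
by case=> _ bcV; split=> //; rewrite boundary_boundary; apply: is_chain0.
Qed.

Lemma phi_boundary_cellular d F (c : {ffun d.+2.-tuple P -> R^o}) :
  is_cellular c ->
  phi F (boundary c) = \sum_(G | rk G == (rk F).+1) phi F (phi G c).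
Proof.
move=> cellular_c; have [cV _] := cellular_c.
rewrite cellular_drop_top // linear_sum [RHS]big_mkcond /=.
apply: eq_bigr => G _; case: ifP => // rkG; apply/ffunP => t.
rewrite !phiE [RHS]ffunE; apply/eqP; apply: contraFT rkG => /cV.
rewrite simplex_rank_skeleton_consE simplex_open_below_consE.
case/and3P=> _ /eqP rkG /andP[/andP[lt0 /rk_lt ltFG] tF].
by rewrite rkG !eqSS eqn_leq (simplex_open_below_rk lt0 tF) -ltnS -rkG ltFG.
Qed.

Lemma cellular_boundary_coface d F (c : {ffun d.+2.-tuple P -> R^o}) :
  is_cellular c -> phi F (boundary c) != 0 -> exists2 G, G \in L & (F < G)%O.
Proof.
move=> cellular_c; rewrite cellular_drop_top //.
have [cV _] := cellular_c; case/(phi_drop_top_neq0 cV) => G.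
by rewrite inE => /andP[GL _]; exists G.
Qed.

Lemma cellular_exact d (c : {ffun d.+1.-tuple P -> R^o}) :
  reduced_homology_vanishes R (rank_skeleton L d.+2) d ->
  is_cellular c -> boundary c = 0 ->
  exists2 y : {ffun d.+2.-tuple P -> R^o}, is_cellular y & boundary y = c.
Proof.
move=> acyclic [cV _] bc.
have sub_skeleton : rank_skeleton L d.+1 \subset rank_skeleton L d.+2.
  by apply/subsetP => F; rewrite !inE => /and3P[-> -> /leqW].
have [y yV by_c] := acyclic c (conj (is_chainS sub_skeleton cV) bc).
by exists y; rewrite // /is_cellular by_c.
Qed.

End CellularChains.

Lemma interval_skeleton_acyclic (R : comNzRingType) G d :
  (d + 3 <= rk G ->
     reduced_homology_vanishes R (truncation_proper_part rk G (d + 3)) d) ->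
  reduced_homology_vanishes R (rank_skeleton [set F | (F <= G)%O] d.+2) d.
Proof.
move=> acyclic; have [le_rk|lt_rk] := leqP (d + 3) (rk G).
  suff <- : truncation_proper_part rk G (d + 3)
      = rank_skeleton [set F | (F <= G)%O] d.+2 by exact: acyclic.
  apply/setP => F; rewrite !inE negb_or rk_gt0 lt0x addn3 ltnS.
  case: (F =P G) => [->|_]; last by case: eqP; rewrite ?andbF.
  by rewrite andbF leqNgt -addn3 le_rk !andbF.
have [G0|nG0] := eqVneq G \bot%O.
  move=> z [zV _]; exists 0%R; rewrite ?linear0; first exact: is_chain0.
  apply/esym/chain_phiP => F; rewrite linear0; apply: phi_notin zV _.
  by rewrite !inE rk_gt0 G0 lex0 lt0x; case: eqP.
apply: (@reduced_homology_vanishes_max _ _ _ _ G) => [|F].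
  by rewrite !inE lexx rk_gt0 lt0x nG0 -ltnS -addn3.
by rewrite !inE => /andP[].
Qed.

End RankedPoset.

Section Labels.
Variables (disp : Order.disp_t) (P : finTBPOrderType disp).
Variables (n : nat) (lab : {A : P | atom A} -> 'X_{1..n}).
Implicit Types (F G : P) (a : 'X_{1..n}).

Lemma labelE F i : label lab F i = \max_(A | (val A <= F)%O) lab A i.
Proof.
by apply/(big_morph (fun m : 'X_{1..n} => m i)) => [x y|]; rewrite mnmE.
Qed.

Lemma label_leP F a :
  reflect (forall A, (val A <= F)%O -> (lab A <= a)%MM) (label lab F <= a)%MM.
Proof.
apply: (iffP mnm_lepP) => [le_a A leA|le_a i].
  apply/mnm_lepP => i; apply: leq_trans (le_a i); rewrite labelE.
  exact: leq_bigmax_cond.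
by rewrite labelE; apply/bigmax_leqP => A /le_a/mnm_lepP.
Qed.

Lemma label_le F G : (F <= G)%O -> (label lab F <= label lab G)%MM.
Proof.
move=> leFG; apply/label_leP => A leAF.
exact: (label_leP _ _ (lepm_refl _)) (le_trans leAF leFG).
Qed.

Definition degree_ideal a : {set P} := [set F | (label lab F <= a)%MM].

Lemma degree_ideal_lower a F G :
  (F <= G)%O -> G \in degree_ideal a -> F \in degree_ideal a.
Proof. by rewrite !inE => /label_le; apply: lepm_trans. Qed.

Lemma label_lt F G :
  injective (label lab) -> (F < G)%O -> exists i, label lab F i < label lab G i.
Proof.
move=> label_inj ltFG; apply/existsP; apply: contraT => /existsPn ge.
have /label_inj eqFG : label lab F = label lab G.
  apply/mnmP => i; apply/eqP; rewrite eqn_leq (mnm_lepP (label_le (ltW ltFG))).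
  by rewrite leqNgt ge.
by rewrite eqFG ltxx in ltFG.
Qed.

Variable rk : P -> nat.
Hypothesis rk_graded : is_rank_function rk.

Lemma label_atom (A : {A : P | atom A}) : label lab (val A) = lab A.
Proof.
have rk_val (B : {A : P | atom A}) : rk (val B) = 1.
  by apply/eqP; rewrite -(atom_rk rk_graded) (valP B).
have atoms_le B : (val B <= val A)%O -> B = A.
  rewrite le_eqVlt => /orP[/eqP/val_inj //|/(rk_lt rk_graded)].
  by rewrite !rk_val.
apply/mnmP => i; rewrite labelE (bigD1 A) //= big1 ?maxn0 // => B.
by case/andP=> /atoms_le->; rewrite eqxx.
Qed.

Lemma complete_degree_ideal a :
  complete lab -> exists G, degree_ideal a = [set F | (F <= G)%O].
Proof.
move=> [_ /(_ a)[G [[Ga Gmax] Guniq]]]; exists G; apply/setP => F; rewrite !inE.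
apply/idP/idP => [Fa|/label_le/lepm_trans]; last exact.
pose above H := (F <= H)%O && (label lab H <= a)%MM.
have aboveF : above F by rewrite /above lexx.
case: (arg_maxnP rk aboveF) => H /andP[leFH Ha] Hmax.
suff -> : G = H by [].
apply: Guniq; split=> // K Ka leHK; apply/eqP; apply: contraT => nKH.
have /(rk_lt rk_graded) : (H < K)%O by rewrite lt_neqAle eq_sym nKH.
by rewrite ltnNge [_ <= _]Hmax // /above (le_trans leFH leHK).
Qed.

End Labels.

Arguments degree_ideal_lower {disp P n} lab a F G _ _.

Lemma lepm_subU n (m a : 'X_{1..n}) i :
  (m <= a)%MM -> m i < a i -> (m <= a - U_(i))%MM.
Proof.
move=> /mnm_lepP le_a lt_i; apply/mnm_lepP => j; rewrite mnmBE mnm1E.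
case: eqP => [<-|_]; last by rewrite subn0.
by rewrite subn1 -ltnS (ltn_predK lt_i).
Qed.

Section Polynomials.
Local Open Scope ring_scope.
Variables (n : nat) (k : fieldType).
Notation S := {mpoly k[n]}.
Implicit Types (p : S) (a b m : 'X_{1..n}).

Lemma mcoeffMX_notin p m a : ~~ (m <= a)%MM -> (p * 'X_[m])@_a = 0.
Proof.
move=> nle; apply/eqP; rewrite mcoeff_eq0 (perm_mem (msuppMX p m)).
by apply: contraNN nle => /mapP[b _ ->]; apply: lem_addr.
Qed.

Lemma homogeneous_of_degreeP a p :
  homogeneous_of_degree a p <-> forall b, b != a -> p@_b = 0.
Proof.
split=> [ha b|ha b bp].
  by apply: contraNeq; rewrite -mcoeff_msupp => /ha->.
by apply/eqP; apply: contraTT bp => /ha /eqP; rewrite mcoeff_eq0.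
Qed.

Lemma homogeneous_of_degreeMX a p m :
  homogeneous_of_degree a (p * 'X_[m])
    <-> forall c, c \in msupp p -> (m + c)%MM = a.
Proof.
rewrite /homogeneous_of_degree; have memMX := perm_mem (msuppMX p m).
split=> [ha c cp|ha b]; first by apply: ha; rewrite memMX map_f.
by rewrite memMX => /mapP[c /ha <- ->].
Qed.

Section Slices.
Variable T : finType.
Implicit Types (c : {ffun T -> S^o}) (z : {ffun T -> k^o}).

Definition slice a c : {ffun T -> k^o} := [ffun t => (c t : S)@_a].

Definition tensor z p : {ffun T -> S^o} := [ffun t => (z t)%:MP * p].

Lemma slice_is_zmod_morphism a : zmod_morphism (slice a).
Proof. by move=> c c'; apply/ffunP => t; rewrite !ffunE mcoeffB. Qed.
HB.instance Definition _ a :=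
  GRing.isZmodMorphism.Build _ _ (slice a) (slice_is_zmod_morphism a).

Lemma slice_inj c c' : (forall a, slice a c = slice a c') -> c = c'.
Proof.
move=> eq_slice; apply/ffunP => t; apply/mpolyP => a.
by have /ffunP/(_ t) := eq_slice a; rewrite !ffunE.
Qed.

Lemma slice_tensor a z p : slice a (tensor z p) = p@_a *: z.
Proof. by apply/ffunP => t; rewrite !ffunE mcoeffCM mulrC. Qed.

Lemma tensor0 p : tensor 0 p = 0.
Proof. by apply/ffunP => t; rewrite !ffunE mpolyC0 mul0r. Qed.

Lemma tensorZ z p q : tensor z (p * q) = p *: tensor z q.
Proof. by apply/ffunP => t; rewrite !ffunE mulrCA. Qed.

Lemma homogeneous_slices a c :
  (forall t, homogeneous_of_degree a (c t))
    <-> forall b, b != a -> slice b c = 0.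
Proof.
split=> [ca b nb|ca t].
  apply/ffunP => t; rewrite !ffunE.
  by have /homogeneous_of_degreeP := ca t; apply.
by apply/homogeneous_of_degreeP => b /ca/ffunP/(_ t); rewrite !ffunE.
Qed.

End Slices.

Lemma slice_expansion (I T : finType) (c : I -> {ffun T -> S^o}) :
  exists B, forall i,
    c i = \sum_(a : 'X_{1..n < B}) tensor (slice a (c i)) 'X_[a].
Proof.
exists (\max_(x : I * T) msize (c x.1 x.2 : S)) => i.
apply/ffunP => t; rewrite sum_ffunE.
under eq_bigr do rewrite !ffunE mul_mpolyC.
apply: mpolywE.
exact: (leq_bigmax (F := fun x : I * T => msize (c x.1 x.2 : S)) (i, t)).
Qed.

Lemma eq_tensor_monomial (T : finType) (Z Z' : {ffun T -> k^o} -> Prop) m c :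
  (forall z, Z z <-> Z' z) -> tensor_monomial Z m c <-> tensor_monomial Z' m c.
Proof.
by move=> eqZ; split=> -[N [z [q [Zz ->]]]]; exists N, z, q; split=> // j;
  apply/eqZ/Zz.
Qed.

Lemma tensor_monomialP (T : finType) (U : {vspace {ffun T -> k^o}}) m
    (c : {ffun T -> S^o}) :
  tensor_monomial (fun z => z \in U) m c
    <-> forall a, slice a c \in (if (m <= a)%MM then U else 0%VS).
Proof.
split=> [[N [z [q [zU ->]]]] a|cU].
  have -> : slice a (\sum_j [ffun t => (z j t)%:MP * (q j * 'X_[m])])
      = \sum_j (q j * 'X_[m])@_a *: z j.
    by rewrite raddf_sum; apply: eq_bigr => j _; apply: slice_tensor.
  apply: rpred_sum => j _; case: ifPn => [_|nle]; first exact: memvZ.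
  by rewrite mcoeffMX_notin // scale0r mem0v.
have [B /(_ tt) cE] := slice_expansion (fun _ : unit => c).
pose I : finType := 'X_{1..n < B}.
exists #|I|, (fun j => slice (val (enum_val j : I)) c),
  (fun j => 'X_[val (enum_val j : I) - m]); split=> [j /=|].
  have := cU (val (enum_val j : I)); case: ifP => // _; rewrite memv0 => /eqP->.
  exact: mem0v.
rewrite -(big_enum_val (fun a : I =>
  tensor (slice a c) ('X_[a - m] * 'X_[m]))) {1}cE /=.
apply: eq_big => [a|a _]; first by rewrite inE.
have := cU a; case: ifP => [le_m_a _|_]; first by rewrite -mpolyXD submK.
by rewrite memv0 => /eqP->; rewrite !tensor0.
Qed.

Lemma eq_graded_free (V : lmodType S) (mem mem' : V -> Prop)
    (comp comp' : 'X_{1..n} -> V -> Prop) :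
  (forall v, mem v <-> mem' v) -> (forall a v, comp a v <-> comp' a v) ->
  graded_free (GModule mem comp) -> graded_free (GModule mem' comp').
Proof.
move=> eq_mem eq_comp [N [b [e [bmem bfree bcomp]]]].
exists N, b, e; split=> // [v|a v] /=.
  by rewrite -eq_mem; apply: bmem.
by rewrite -eq_comp; apply: bcomp.
Qed.

Lemma graded_free_fintype (M : gmodule k n) (I : finType) (b : I -> M)
    (e : I -> 'X_{1..n}) :
  (forall v, gmem v <-> exists p : I -> S, v = \sum_i p i *: b i) ->
  (forall p : I -> S, \sum_i p i *: b i = 0 -> forall i, p i = 0) ->
  (forall a v, gcomp a v <->
     exists2 p : I -> S,
       forall i c, c \in msupp (p i) -> (e i + c)%MM = a
       & v = \sum_i p i *: b i) ->
  graded_free M.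
Proof.
move=> bmem bfree bcomp.
have sum_rank (p : 'I_#|I| -> S) :
    \sum_j p j *: b (enum_val j) = \sum_i p (enum_rank i) *: b i.
  rewrite (reindex (@enum_rank I)) /=; last exact/onW_bij/enum_rank_bij.
  by apply: eq_bigr => i _; rewrite enum_rankK.
have sum_val (p : I -> S) :
    \sum_i p i *: b i = \sum_(j < #|I|) p (enum_val j) *: b (enum_val j).
  rewrite [RHS](sum_rank (p \o enum_val)).
  by apply: eq_bigr => i _; rewrite /= enum_rankK.
exists #|I|, (b \o enum_val), (e \o enum_val); split=> [v|p|a v] /=.
- split=> [/bmem[p ->]|[p ->]]; last by apply/bmem; rewrite sum_rank; eexists.
  by exists (p \o enum_val); rewrite sum_val.
- by rewrite sum_rank => /bfree p0 j; rewrite -[j]enum_valK.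
split=> [/bcomp[p pa ->]|[p pa ->]].
  by exists (p \o enum_val) => [j|]; [apply: pa | rewrite sum_val].
apply/bcomp; exists (p \o enum_rank) => [i c|]; last exact: sum_rank.
by rewrite -{2}[i]enum_rankK; apply: pa.
Qed.

End Polynomials.

Section SumsOfMonomialTensors.
Local Open Scope ring_scope.
Variables (n : nat) (k : fieldType) (I T : finType).
Variables (U : I -> {vspace {ffun T -> k^o}}) (m : I -> 'X_{1..n}).
Notation S := {mpoly k[n]}.

Definition tensor_sum_mem (c : {ffun I -> {ffun T -> S^o}}) : Prop :=
  forall i, tensor_monomial (fun z => z \in U i) (m i) (c i).

Definition tensor_sum_comp a (c : {ffun I -> {ffun T -> S^o}}) : Prop :=
  tensor_sum_mem c /\ forall i t, homogeneous_of_degree a (c i t : S).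

Definition tensor_sum : gmodule k n := GModule tensor_sum_mem tensor_sum_comp.

Definition tensor_index : finType := {i : I & 'I_(\dim (U i))}.

Definition tensor_basis (j : tensor_index) : tensor_sum :=
  [ffun i => if i == tag j
             then tensor ((vbasis (U (tag j)))`_(tagged j)) 'X_[m i] else 0].

Lemma tensor_basis_sumE (p : tensor_index -> S) i :
  (\sum_j p j *: tensor_basis j) i
    = \sum_(l < \dim (U i))
        tensor ((vbasis (U i))`_l) (p (Tagged _ l) * 'X_[m i]).
Proof.
rewrite sum_ffunE.
transitivity (\sum_i' \sum_(l < \dim (U i'))
    (p (Tagged _ l) *: tensor_basis (Tagged _ l)) i).
  by rewrite [RHS]sig_big_dep; apply: eq_bigr => -[i' l] _.
rewrite (bigD1 i) //= [X in _ + X]big1 ?addr0 => [|i' ni].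
  by apply: eq_bigr => l _; rewrite tensorZ !ffunE eqxx.
by apply: big1 => l _; rewrite !ffunE eq_sym (negPf ni) scaler0.
Qed.

Lemma slice_tensor_basis_sum (p : tensor_index -> S) i a :
  slice a ((\sum_j p j *: tensor_basis j) i)
    = \sum_(l < \dim (U i))
        (p (Tagged _ l) * 'X_[m i])@_a *: (vbasis (U i))`_l.
Proof.
rewrite tensor_basis_sumE raddf_sum; apply: eq_bigr => l _.
exact: slice_tensor.
Qed.

Lemma slice_tensor_basis_eq0 (p : tensor_index -> S) i a :
  slice a ((\sum_j p j *: tensor_basis j) i) = 0
    <-> forall l : 'I_(\dim (U i)), (p (Tagged _ l) * 'X_[m i])@_a = 0.
Proof.
rewrite slice_tensor_basis_sum; split=> [|p0]; last first.
  by rewrite big1 // => l _; rewrite p0 scale0r.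
exact/freeP/(basis_free (vbasisP _)).
Qed.

Lemma tensor_basis_free (p : tensor_index -> S) :
  \sum_j p j *: tensor_basis j = 0 -> forall j, p j = 0.
Proof.
move=> sum0 [i l]; apply/mpolyP => c; rewrite mcoeff0 -(mcoeffMX _ (m i)).
by apply: (slice_tensor_basis_eq0 p i _).1; rewrite sum0 ffunE raddf0.
Qed.

Lemma tensor_sum_memP (c : tensor_sum) :
  gmem c <-> exists p : tensor_index -> S, c = \sum_j p j *: tensor_basis j.
Proof.
split=> [cm|[p ->] i]; last first.
  rewrite tensor_basis_sumE; exists (\dim (U i)), (fun l => (vbasis (U i))`_l),
    (fun l => p (Tagged _ l)); split=> // l.
  by apply/vbasis_mem/mem_nth; rewrite size_tuple.
suff /fin_all_exists[p cE] : forall i, exists p : 'I_(\dim (U i)) -> S,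
    c i = \sum_(l < \dim (U i)) tensor ((vbasis (U i))`_l) (p l * 'X_[m i]).
  exists (fun j => p (tag j) (tagged j)).
  by apply/ffunP => i; rewrite tensor_basis_sumE.
move=> i; have [N [z [q [zU ->]]]] := cm i.
exists (fun l => \sum_j (coord (vbasis (U i)) l (z j))%:MP * q j).
apply: slice_inj => a; rewrite !raddf_sum /=.
under eq_bigr do rewrite [slice a _]slice_tensor {1}(coord_vbasis (zU _))
  scaler_sumr.
rewrite exchange_big; apply: eq_bigr => l _; rewrite slice_tensor mulr_suml.
rewrite raddf_sum scaler_suml; apply: eq_bigr => j _.
by rewrite -mulrA /= mcoeffCM scalerA mulrC.
Qed.

Lemma tensor_sum_compP a (c : tensor_sum) :
  gcomp a c <->
  exists2 p : tensor_index -> S,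
    forall j b, b \in msupp (p j) -> (m (tag j) + b)%MM = a
    & c = \sum_j p j *: tensor_basis j.
Proof.
split=> [[/tensor_sum_memP[p cE] ca]|[p pa cE]].
  exists p => // -[i l]; apply/homogeneous_of_degreeMX/homogeneous_of_degreeP.
  move=> b nb; apply: (slice_tensor_basis_eq0 p i b).1; rewrite -cE.
  exact: (homogeneous_slices _ _).1 (ca i) _ nb.
split=> [|i]; first by apply/tensor_sum_memP; exists p.
apply/homogeneous_slices => b nb; rewrite cE; apply/slice_tensor_basis_eq0 => l.
move: b nb; apply/homogeneous_of_degreeP/homogeneous_of_degreeMX.
exact: pa (Tagged _ l).
Qed.

Lemma tensor_sum_graded_free : graded_free tensor_sum.
Proof.
apply: (graded_free_fintype (b := tensor_basis) (e := fun j => m (tag j))).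
- exact: tensor_sum_memP.
- exact: tensor_basis_free.
exact: tensor_sum_compP.
Qed.

End SumsOfMonomialTensors.

Section CycleSpace.
Local Open Scope ring_scope.
Variables (disp : Order.disp_t) (P : finPOrderType disp) (k : fieldType).
Implicit Types (V : {set P}) (s : nat).

Definition off_simplices V s (c : {ffun s.-tuple P -> k^o}) :
    {ffun s.-tuple P -> k^o} :=
  [ffun t => if is_simplex V t then 0 else c t].

Lemma off_simplices_linear V s : linear (@off_simplices V s).
Proof.
move=> a c c'; apply/ffunP => t; rewrite !ffunE.
by case: ifP => // _; rewrite scaler0 addr0.
Qed.
HB.instance Definition _ V s := GRing.isLinear.Build k _ _ _
  (@off_simplices V s) (@off_simplices_linear V s).

Definition cycle_space V s : {vspace {ffun s.-tuple P -> k^o}} :=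
  (lker (linfun (@boundary _ P k s)) :&: lker (linfun (@off_simplices V s)))%VS.

Lemma cycle_spaceP V s (c : {ffun s.-tuple P -> k^o}) :
  reflect (is_cycle V c) (c \in cycle_space V s).
Proof.
rewrite memv_cap !memv_ker !lfunE.
apply: (iffP andP) => [[/eqP bc /eqP/ffunP c_off]|[cV bc]]; split=> //.
- move=> t; apply: contraNT => /negPf nt.
  by have := c_off t; rewrite !ffunE nt => ->.
- exact/eqP.
apply/eqP/ffunP => t; rewrite !ffunE; case: ifPn => // nt.
by apply/eqP; apply: contraNT nt => /cV.
Qed.

End CycleSpace.

Section MaximalIdealMultiples.
Local Open Scope ring_scope.
Variables (k : fieldType) (n : nat) (M : gmodule k n).
Hypothesis gmem0 : gmem (0 : M).
Hypothesis gmemD : forall v w : M, gmem v -> gmem w -> gmem (v + w).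

Lemma in_maximal_ideal_mul0 : in_maximal_ideal_mul (0 : M).
Proof. by exists (fun=> 0) => //; rewrite big1 // => i _; rewrite scaler0. Qed.

Lemma in_maximal_ideal_mulD (v w : M) :
  in_maximal_ideal_mul v -> in_maximal_ideal_mul w ->
  in_maximal_ideal_mul (v + w).
Proof.
move=> [v' v'm ->] [w' w'm ->]; exists (fun i => v' i + w' i) => [i|].
  exact: gmemD.
by rewrite -big_split; apply: eq_bigr => i _; rewrite scalerDr.
Qed.

End MaximalIdealMultiples.

Section PosetComplexStrands.
Local Open Scope ring_scope.
Variables (k : fieldType) (n : nat).
Variables (disp : Order.disp_t) (P : finTBPOrderType disp).
Variables (rk : P -> nat) (lab : {A : P | atom A} -> 'X_{1..n}).
Hypothesis rk_graded : is_rank_function rk.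
Notation S := {mpoly k[n]}.
Notation C := (poset_module k rk lab).
Implicit Types (F G : P) (a b : 'X_{1..n}).

Local Notation is_cellular_below a := (is_cellular rk (degree_ideal lab a)).

Definition cycle_summand d F : {vspace {ffun d.-tuple P -> k^o}} :=
  if rk F == d.+1 then cycle_space k (open_below F) d else 0%VS.

Lemma poset_mem_tensor d (c : poset_chain k n P d) :
  poset_mem rk lab c <-> tensor_sum_mem (@cycle_summand d) (label lab) c.
Proof.
suff summandE F : (if rk F == d.+1
    then tensor_monomial (@is_cycle _ P k (open_below F) d) (label lab F) (c F)
    else c F = 0)
  <-> tensor_monomial (fun z => z \in cycle_summand d F) (label lab F) (c F).
  by split=> cm F; have := cm F => /summandE.
rewrite /cycle_summand; case: ifP => _.
  by apply: eq_tensor_monomial => z; exact: rwP (cycle_spaceP _ _).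
rewrite tensor_monomialP; split=> [-> a|c0].
  by rewrite raddf0 if_same mem0v.
by apply: slice_inj => a; have := c0 a; rewrite if_same memv0 raddf0 => /eqP.
Qed.

Lemma poset_graded_free d : graded_free (C d).
Proof.
have := tensor_sum_graded_free (@cycle_summand d) (label lab).
apply: eq_graded_free => [c|a c].
  by split=> /poset_mem_tensor.
by split=> -[/poset_mem_tensor].
Qed.

(* The degree a part of c. Coning off each c_F with apex F turns phi into the
   simplicial boundary. *)
Definition strand d a (c : C d) : {ffun d.+1.-tuple P -> k^o} :=
  \sum_F cone F (slice a (c F)).

Lemma phi_strand d a F (c : C d) : phi F (strand a c) = slice a (c F).
Proof. exact: phi_sum_cone. Qed.

Lemma strand_inj d (c c' : C d) :
  (forall a, strand a c = strand a c') -> c = c'.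
Proof.
move=> eq_strand; apply/ffunP => F; apply: slice_inj => a.
by rewrite -!phi_strand eq_strand.
Qed.

Lemma strand_is_zmod_morphism d a : zmod_morphism (@strand d a).
Proof.
move=> c c'; apply: chain_phiP => F.
by rewrite linearB /= !phi_strand !ffunE raddfB.
Qed.
HB.instance Definition _ d a := GRing.isZmodMorphism.Build (C d) _
  (@strand d a) (@strand_is_zmod_morphism d a).

Lemma cellular_summandP d a (y : {ffun d.+1.-tuple P -> k^o}) :
  is_cellular_below a y <->
  forall F, phi F y \in
    (if (label lab F <= a)%MM then cycle_summand d F else 0%VS).
Proof.
have cellularP := cellularP rk_graded (degree_ideal_lower lab a) y.
split=> [/cellularP y_cell F|y_cell].
  have := y_cell F; rewrite inE /cycle_summand.
  by case: (label lab F <= a)%MM; case: (rk F == d.+1) => /=;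
    do [move/cycle_spaceP | move->; apply: mem0v].
apply/cellularP => F; have := y_cell F; rewrite inE /cycle_summand.
by case: (label lab F <= a)%MM; case: (rk F == d.+1) => /=;
  do [move/cycle_spaceP | rewrite memv0 => /eqP].
Qed.

Lemma poset_mem_cellular d (c : C d) :
  gmem c <-> forall a, is_cellular_below a (strand a c).
Proof.
split=> [/poset_mem_tensor cm a|c_cell].
  apply/cellular_summandP => F; rewrite phi_strand.
  by move: a; apply/tensor_monomialP.
apply/poset_mem_tensor => F; apply/tensor_monomialP => a.
by have /cellular_summandP/(_ F) := c_cell a; rewrite phi_strand.
Qed.

Lemma strand_cellular d a (c : C d) :
  gmem c -> is_cellular_below a (strand a c).
Proof. by move/poset_mem_cellular. Qed.

Lemma poset_compP d a (c : C d) :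
  gcomp a c <-> gmem c /\ forall b, b != a -> strand b c = 0.
Proof.
split=> -[cm ca]; split=> //.
  move=> b nb; apply: chain_phiP => F; rewrite phi_strand linear0.
  exact: (homogeneous_slices _ _).1 (ca F) _ nb.
move=> F; apply/homogeneous_slices => b /ca strand0.
by rewrite -phi_strand strand0 linear0.
Qed.

Lemma poset_mem0 d : gmem (0 : C d).
Proof. by apply/poset_mem_cellular => a; rewrite raddf0; apply: cellular0. Qed.

Lemma poset_memD d (c c' : C d) : gmem c -> gmem c' -> gmem (c + c').
Proof.
move=> /poset_mem_tensor cm /poset_mem_tensor cm'; apply/poset_mem_tensor => F.
apply/tensor_monomialP => a; rewrite ffunE raddfD /=.
by apply: memvD; apply/tensor_monomialP: a.
Qed.

Definition monomial_chain d a (y : {ffun d.+1.-tuple P -> k^o}) : C d :=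
  [ffun F => tensor (phi F y) 'X_[a]].

Lemma strand_monomial_chain d a b (y : {ffun d.+1.-tuple P -> k^o}) :
  strand b (monomial_chain a y) = if a == b then y else 0.
Proof.
apply: chain_phiP => F; rewrite phi_strand ffunE slice_tensor mcoeffX.
by case: eqP => _; rewrite ?scale1r // scale0r linear0.
Qed.

Lemma monomial_chain_mem d a (y : {ffun d.+1.-tuple P -> k^o}) :
  is_cellular_below a y -> gmem (monomial_chain a y).
Proof.
move=> y_cell; apply/poset_mem_cellular => b; rewrite strand_monomial_chain.
by case: (a =P b) => [<-|_] //; apply: cellular0.
Qed.

Lemma poset_chain_ind d (Q : C d -> Prop) (c : C d) :
  Q 0 -> (forall c1 c2, Q c1 -> Q c2 -> Q (c1 + c2)) ->
  (forall a, Q (monomial_chain a (strand a c))) -> Q c.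
Proof.
move=> Q0 QD Qc; have [B cE] := slice_expansion c.
suff -> : c = \sum_(a : 'X_{1..n < B}) monomial_chain a (strand a c).
  exact: big_ind.
apply/ffunP => F; rewrite cE sum_ffunE; apply: eq_bigr => a _.
by rewrite ffunE phi_strand.
Qed.

Lemma strand_del d a (c : C d.+1) :
  gmem c -> strand a (poset_del c) = boundary (strand a c).
Proof.
move=> /(strand_cellular a) c_cell; apply: chain_phiP => F.
rewrite phi_strand ffunE raddf_sum.
rewrite (phi_boundary_cellular rk_graded (degree_ideal_lower lab a)) //.
apply: eq_bigr => G _; rewrite phi_strand.
by apply/ffunP => t; rewrite !(ffunE, phiE).
Qed.

Lemma strand_aug a (v : C 0) :
  gmem v -> (poset_aug v : S)@_a = boundary (strand a v) [tuple].
Proof.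
move=> vm; rewrite boundary_point sum_ffunE raddf_sum big_mkcond.
apply: eq_bigr => F _; rewrite phi_strand ffunE (atom_rk rk_graded).
by have := vm F; case: ifP => // _ ->; rewrite ffunE mcoeff0.
Qed.

Lemma poset_scaleE d (p : S) (c c' : C d) F : (p *: c + c') F = p *: c F + c' F.
Proof. by rewrite ffunE [X in X + _]ffunE. Qed.

Lemma poset_delE d (c : C d.+1) F :
  poset_del c F = \sum_(G | rk G == (rk F).+1) phi F (c G).
Proof. exact: ffunE. Qed.

Lemma poset_del_linear d : linear (@poset_del k n disp P rk lab d).
Proof.
move=> p c c'; apply/ffunP => F; rewrite [LHS]poset_delE [RHS]poset_scaleE.
rewrite [X in _ = p *: X + _]poset_delE [X in _ = _ + X]poset_delE.
rewrite scaler_sumr -big_split; apply: eq_bigr => G _.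
by rewrite poset_scaleE linearP.
Qed.
HB.instance Definition _ d := GRing.isLinear.Build S (C d.+1) (C d) _
  (@poset_del k n disp P rk lab d) (@poset_del_linear d).

Lemma poset_del_mem d (c : C d.+1) : gmem c -> gmem (poset_del c).
Proof.
move=> cm; apply/poset_mem_cellular => a; rewrite strand_del //.
exact/cellular_boundary/strand_cellular.
Qed.

Lemma poset_del_eq0 d (v : C d.+1) :
  gmem v -> poset_del v = 0 <-> forall a, boundary (strand a v) = 0.
Proof.
move=> vm; split=> [del0 a|bv0]; first by rewrite -strand_del // del0 raddf0.
by apply: strand_inj => a; rewrite strand_del // bv0 raddf0.
Qed.

Lemma poset_aug_eq0 (v : C 0) :
  gmem v -> poset_aug v = 0 <-> forall a, boundary (strand a v) = 0.
Proof.
move=> vm; split=> [aug0 a|bv0].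
  apply/ffunP => t; rewrite (tuple0 t) -strand_aug // aug0 ffunE.
  exact: mcoeff0.
by apply/mpolyP => a; rewrite strand_aug // bv0 ffunE mcoeff0.
Qed.

Lemma poset_del_hom d : graded_hom (@poset_del k n disp P rk lab d).
Proof.
split=> [|p v w _ _|a v /poset_compP[vm va]]; first exact: poset_del_mem.
  exact: poset_del_linear.
apply/poset_compP; split=> [|b nb]; first exact: poset_del_mem.
by rewrite strand_del // va // linear0.
Qed.

Lemma poset_aug_hom : graded_hom (@poset_aug k n disp P rk lab).
Proof.
split=> // [p v w _ _|a v /poset_compP[vm va]].
  rewrite /poset_aug scaler_sumr -big_split; apply: eq_bigr => A _.
  by rewrite !ffunE.
apply/homogeneous_of_degreeP => b nb.
by rewrite strand_aug // va // linear0 ffunE.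
Qed.

Lemma in_maximal_ideal_mul_monomial_chain d a
    (y : {ffun d.+1.-tuple P -> k^o}) :
  is_cellular_below a y ->
  (forall F, phi F y != 0 -> exists i, (label lab F i < a i)%N) ->
  in_maximal_ideal_mul (monomial_chain a y : C d).
Proof.
move=> /cellular_summandP y_cell lt_label.
pose index F := [pick i | (label lab F i < a i)%N].
pose part i := \sum_F cone F (if index F == Some i then phi F y else 0).
have phi_part i F : phi F (part i) = if index F == Some i then phi F y else 0.
  exact: phi_sum_cone.
exists (fun i => monomial_chain (a - U_(i))%MM (part i)) => [i|].
  apply/monomial_chain_mem/cellular_summandP => F; rewrite phi_part.
  rewrite /index; case: pickP => [j ltj|_]; last exact: mem0v.
  case: eqP => [[<-]|_]; last exact: mem0v.
  have := y_cell F; case: ifP => [le_a|_]; first by rewrite lepm_subU.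
  by rewrite memv0 => /eqP->; apply: mem0v.
apply/ffunP => F; rewrite ffunE sum_ffunE.
under eq_bigr => i _ do rewrite ffunE ffunE phi_part -tensorZ.
have [->|/lt_label[i lt_i]] := eqVneq (phi F y) 0.
  by rewrite big1 => [|i _]; rewrite ?if_same tensor0.
rewrite /index; case: pickP => [j ltj|/(_ i)]; last by rewrite lt_i.
rewrite (bigD1 j) //= eqxx big1 ?addr0 => [|l nl]; last first.
  by rewrite (inj_eq Some_inj) eq_sym (negPf nl) tensor0.
by rewrite -mpolyXD addmC submK // lep1mP -lt0n (leq_ltn_trans _ ltj).
Qed.

Lemma poset_minimal d (v : C d.+1) :
  injective (label lab) -> gmem v -> in_maximal_ideal_mul (poset_del v).
Proof.
move=> label_inj vm.
apply: (poset_chain_ind (Q := @in_maximal_ideal_mul k n (C d))).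
- exact/in_maximal_ideal_mul0/poset_mem0.
- exact/in_maximal_ideal_mulD/poset_memD.
move=> a; apply: in_maximal_ideal_mul_monomial_chain => [|F].
  exact/strand_cellular/poset_del_mem.
rewrite strand_del //.
case/(cellular_boundary_coface rk_graded (degree_ideal_lower lab a)
  (strand_cellular a vm)) => G.
rewrite inE => /mnm_lepP le_a /(label_lt label_inj)[i lt_i].
by exists i; apply: leq_trans lt_i (le_a i).
Qed.

Lemma poset_exact d (v : C d) :
  complete lab ->
  (forall G, (d + 3 <= rk G)%N ->
     reduced_homology_vanishes k (truncation_proper_part rk G (d + 3)) d) ->
  gmem v -> (forall a, boundary (strand a v) = 0) ->
  exists2 w : C d.+1, gmem w & poset_del w = v.
Proof.
move=> P_complete acyclic vm bv0.
apply: (poset_chain_ind (Q := fun u => exists2 w, gmem w & poset_del w = u)).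
- by exists 0; [apply: poset_mem0 | apply: linear0].
- move=> _ _ [w wm <-] [w' w'm <-].
  by exists (w + w'); [apply: poset_memD | apply: linearD].
move=> a; have [G eqG] := complete_degree_ideal rk_graded a P_complete.
have [|y y_cell by_v] := cellular_exact _ (strand_cellular a vm) (bv0 a).
  by rewrite eqG; apply/interval_skeleton_acyclic/acyclic.
have ym := monomial_chain_mem y_cell.
exists (monomial_chain a y) => //; apply: strand_inj => b.
rewrite strand_del // !strand_monomial_chain -by_v.
by case: (a == b); rewrite ?linear0.
Qed.

Lemma poset_boundaryP d (v : C d) :
  complete lab ->
  (forall G, (d + 3 <= rk G)%N ->
     reduced_homology_vanishes k (truncation_proper_part rk G (d + 3)) d) ->
  gmem v ->
  (forall a, boundary (strand a v) = 0)
    <-> exists2 w : C d.+1, gmem w & poset_del w = v.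
Proof.
move=> P_complete acyclic vm; split=> [|[w wm <-] a]; first exact: poset_exact.
by rewrite strand_del // boundary_boundary.
Qed.

Lemma poset_aug_sub (v : C 0) :
  poset_aug v = \sum_(A : {A : P | atom A}) v (val A) [tuple].
Proof. exact: (big_sub (fun F => atom F)). Qed.

Lemma poset_aug_image (p : S) :
  poset_ideal lab p <-> exists2 v : C 0, gmem v & poset_aug v = p.
Proof.
split=> [[q ->]|[v vm <-]].
  exists [ffun F => [ffun _ => oapp (fun A => q A * 'X_[lab A]) 0 (insub F)]].
    move=> F; rewrite ffunE -(atom_rk rk_graded); case: ifPn => [atomF|nF].
      rewrite insubT /=.
      exists 1%N, (fun=> [ffun=> 1]), (fun=> q (Sub F atomF)).
      split=> [_|].
        split; last exact: boundary_empty.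
        by move=> t _; rewrite (tuple0 t).
      apply/ffunP => t; rewrite big_ord1 !ffunE mul1r.
      by rewrite -(label_atom lab rk_graded (Sub F atomF)).
    by rewrite insubN //; apply/ffunP => t; rewrite !ffunE.
  by rewrite poset_aug_sub; apply: eq_bigr => A _; rewrite !ffunE valK.
have /fin_all_exists[q vq] : forall A : {A : P | atom A}, exists q : S,
    v (val A) [tuple] = q * 'X_[lab A].
  move=> A; have := vm (val A); rewrite -(atom_rk rk_graded) (valP A).
  case=> N [z [q [_ ->]]]; exists (\sum_j (z j [tuple])%:MP * q j).
  rewrite sum_ffunE mulr_suml; apply: eq_bigr => j _.
  by rewrite ffunE (label_atom lab rk_graded) mulrA.
by exists q; rewrite poset_aug_sub; apply: eq_bigr => A _.
Qed.

End PosetComplexStrands.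

Theorem theorem3p9 (k : fieldType) (n : nat)
    (disp : Order.disp_t) (P : finTBPOrderType disp)
    (rk : P -> nat) (r : nat) (lab : {A : P | atom A} -> 'X_{1..n})
    (rk_graded : is_rank_function rk) (rk_top : rk \top%O = r)
    (P_complete : complete lab)
    (P_homology : forall (i : nat) (F : P),
       i + 3 <= r -> i + 3 <= rk F ->
       reduced_homology_vanishes k (truncation_proper_part rk F (i + 3)) i) :
  minimal_graded_free_resolution
    (@poset_del k n disp P rk lab) (@poset_aug k n disp P rk lab)
    (@poset_ideal disp P n lab k).
Proof.
have acyclic d (G : P) : d + 3 <= rk G ->
    reduced_homology_vanishes k (truncation_proper_part rk G (d + 3)) d.
  move=> le_rk; apply: P_homology => //; apply: leq_trans le_rk _.
  by rewrite -rk_top (rk_le rk_graded) ?lex1.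
split.
- exact: poset_graded_free.
- by split; [apply: poset_del_hom | apply: poset_aug_hom].
- split=> [d|] v vm; [rewrite poset_del_eq0 // | rewrite poset_aug_eq0 //].
    exact: poset_boundaryP P_complete (acyclic _) vm.
  exact: poset_boundaryP P_complete (acyclic _) vm.
- exact: poset_aug_image.
by move=> d v; apply: poset_minimal; case: P_complete.
Qed.
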